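(* Let $h>0$, $p>0$, let $Q\geq 0$ be a fixed order quantity, and for $\lambda>0$ let \[G_Q(\lambda)=h\left(Q-\frac{1}{\lambda}\right)+(h+p)\int_{Q}^{\infty}\bigl(1-F(\lambda,x)\bigr)\,\mathrm{d}x ,\] where $F(\lambda,\cdot)$ is the cumulative distribution function of the exponential distribution with rate $\lambda$. Then $\lim_{\lambda\to 0}G_Q(\lambda)=\infty$; $\lim_{\lambda\to\infty}G_Q(\lambda)=hQ^-$, meaning that $G_Q(\lambda)$ tends to $hQ$ from below as $\lambda\to\infty$; the function $G_Q$ admits a single global minimum $\lambda^*$; and it is strictly increasing for $\lambda>\lambda^*$ and strictly decreasing for $\lambda<\lambda^*$.
   Context: The exponential distribution with rate $\lambda>0$ has density $\lambda e^{-\lambda x}$ for $x\geq 0$ and mean $1/\lambda$, so $F(\lambda,x)=1-e^{-\lambda x}$ for $x\geq 0$. $G_Q(\lambda)$ is the expected total newsvendor cost of the fixed order quantity $Q$ under exponentially distributed demand with rate $\lambda$, with unit overage cost $h$ and unit underage cost $p$. ''Single global minimum $\lambda^*$'' means that the minimum is attained at the single point $\lambda^*$.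
   Formalization: The statement is false at Q = 0, where G_0(λ) = p/λ has no minimum and tends to 0 from above; the approach from below, the single global minimum and the monotonicity on its two sides are therefore claimed only for Q > 0, while both limits are kept for all Q ≥ 0. *)

(* Defs.v *)
From mathcomp Require Import all_boot all_order all_algebra.
From mathcomp Require Import all_classical all_reals all_analysis.

Set Implicit Arguments.
Unset Strict Implicit.
Unset Printing Implicit Defensive.

Import Order.TTheory GRing.Theory Num.Theory.
Import numFieldNormedType.Exports.

Local Open Scope classical_set_scope.
Local Open Scope ring_scope.

(* The library declares [exponential_prob l] as a probability measure only under
   a proof of [0 < l], so the generic [cdf] does not apply to a bare rate [l]. *)
Definition exponential_cdf (R : realType) (l x : R) : R :=
  fine (exponential_prob l `]-oo, x]).

(* Expected newsvendor cost of the order quantity [Q] under exponential demand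
   with rate [l], unit overage cost [h] and unit underage cost [p]; meaningful
   for [0 < l]. *)
Definition newsvendor_cost (R : realType) (h p Q l : R) : R :=
  h * (Q - l^-1) +
  (h + p) * \int[lebesgue_measure]_(x in `[Q, +oo[) (1 - exponential_cdf l x).

Definition is_global_min (R : realType) (G : R -> R) (l : R) : Prop :=
  0 < l /\ forall m : R, 0 < m -> G l <= G m.

(* Main.v *)
(* The cost is h Q + ((h + p) e^{-lQ} - h) / l. For Q > 0 its derivative in l has
   the sign of h e^{lQ} - (h + p) (1 + lQ), which vanishes at a single l > 0, is
   negative before it and positive after it. Differentiation is not needed: when
   the costs at two rates are compared directly, both the sign and the strict
   monotonicity come down to 1 + u < e^u for nonzero u. *)
Require Import Defs.
From mathcomp Require Import all_boot all_order all_algebra.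
From mathcomp Require Import all_classical all_reals all_analysis.
From mathcomp Require Import ring lra.

Set Implicit Arguments.
Unset Strict Implicit.
Unset Printing Implicit Defensive.

Import Order.TTheory GRing.Theory Num.Theory.
Import numFieldNormedType.Exports.

Local Open Scope classical_set_scope.
Local Open Scope ring_scope.

(** The density vanishes on the negative half-line, so only the mass of [0, x] counts. *)
Lemma exponential_cdfE (R : realType) (l x : R) : 0 < l -> 0 <= x ->
  exponential_cdf l x = 1 - expR (- l * x).
Proof.
move=> l0 x0; rewrite /exponential_cdf /exponential_prob.
have -> : `]-oo, x]%classic = `]-oo, 0[ `|` `[0, x].
  by rewrite -itv_bndbnd_setU// bnd_simp.
have pdf_ge0 := exponential_pdf_ge0 (ltW l0).
rewrite ge0_integral_setU//=; last 3 first.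
- apply/measurable_realfun.measurable_EFinP/measurable_funTS.
  exact: measurable_exponential_pdf.
- by move=> y _; rewrite lee_fin.
- apply/disj_setPS => y /= []; rewrite !in_itv/= => y0 /andP[].
  by rewrite leNgt y0.
rewrite integral0_eq ?add0e; last first.
  by move=> y /=; rewrite in_itv/= => y0; rewrite lt0_exponential_pdf.
(* The closed form for the mass of [0, x] requires 0 < x. *)
have [->|xn0] := eqVneq x 0.
  by rewrite set_itv1 integral_set1 mulr0 expR0 subrr.
have {xn0}x_gt0 : 0 < x by rewrite lt_neqAle eq_sym xn0.
by have := exponential_prob_itv0c l x_gt0; rewrite /exponential_prob => ->.
Qed.

Lemma Rintegral_expRN (R : realType) (l Q : R) : 0 < l ->
  \int[lebesgue_measure]_(x in `[Q, +oo[) expR (- l * x) = expR (- l * Q) / l.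
Proof.
move=> l0.
have cexp : continuous (fun x : R => expR (- l * x)).
  move=> z; apply: continuous_comp; last exact: continuous_expR.
  by apply: continuousM => //; exact: cst_continuous.
(* The final argument [0] is the limit of the antiderivative at infinity. *)
rewrite (@Rintegral_ge0_continuous_FTC2y _ _
  (fun x => - l^-1 * expR (- l * x)) Q 0).
- by rewrite sub0r mulNr opprK mulrC.
- by move=> x _; exact: expR_ge0.
- exact: continuous_subspaceT.
- rewrite -[X in _ --> X](mulr0 (- l^-1)); apply: cvgM; first exact: cvg_cst.
  rewrite (_ : (fun x => _) = (fun z => expR (- z)) \o *%R l); last first.
    by apply/funext => x /=; rewrite mulNr.
  apply: (@cvg_comp _ _ _ _ _ _ (pinfty_nbhs R)); last exact: cvgr_expR.
  exact: gt0_cvgMry.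
- by move=> x _; exact: ex_derive.
- by apply: cvgM; [exact: cvg_cst|apply/cvg_at_right_filter; exact: cexp].
- move=> x _; rewrite derive1E.
  have -> := derive_val (is_derive := _).
  by rewrite /GRing.scale/= ; field; rewrite gt_eqF.
Qed.

Lemma newsvendor_costE (R : realType) (h p Q l : R) : 0 <= Q -> 0 < l ->
  newsvendor_cost h p Q l = h * Q + ((h + p) * expR (- l * Q) - h) / l.
Proof.
move=> Q0 l0; rewrite /newsvendor_cost.
have -> : \int[lebesgue_measure]_(x in `[Q, +oo[) (1 - exponential_cdf l x) =
    \int[lebesgue_measure]_(x in `[Q, +oo[) expR (- l * x).
  apply: eq_Rintegral.
  move=> x; rewrite inE/= in_itv/= andbT => Qx.
  by rewrite exponential_cdfE// ?(le_trans Q0)// opprB addrCA subrr addr0.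
by rewrite Rintegral_expRN//; field; rewrite gt_eqF.
Qed.

(* At l = 0 the affine bound 1 - l Q is tangent to e^{-lQ}, and what is left of
   the cost still blows up like p / l. *)
Lemma newsvendor_cost_ge (R : realType) (h p Q l : R) :
  0 < h -> 0 < p -> 0 <= Q -> 0 < l ->
  p / l - p * Q <= newsvendor_cost h p Q l.
Proof.
move=> h0 p0 Q0 l0; rewrite newsvendor_costE//.
have e := expR_ge1Dx (- l * Q).
rewrite -subr_ge0.
rewrite (_ : _ - _ = (h + p) * (expR (- l * Q) - (1 + - l * Q)) / l); last first.
  by field; rewrite gt_eqF.
by rewrite divr_ge0 ?mulr_ge0 ?subr_ge0// ?addr_ge0// ltW.
Qed.

(** In the variable t = lQ this is the stationarity equation of the cost. The intermediate value
    theorem applies: h e^t - (h + p)(1 + t) is -p at 0, which also keeps the root away from 0, and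
    is nonnegative at [T]. *)
Lemma expR_affine_root (R : realType) (h p : R) : 0 < h -> 0 < p ->
  exists2 t : R, 0 < t & (h + p) * (1 + t) = h * expR t.
Proof.
move=> h0 p0; set a := h + p; set T := 4 * a / h.
(* At T, already h (1 + T/2)^2 >= a (1 + T), while e^T >= (1 + T/2)^2. *)
have a0 : 0 < a by exact: addr_gt0.
have T0 : 0 < T by rewrite divr_gt0// mulr_gt0.
pose f t := h * expR t - a * (1 + t).
have fc : continuous f.
  move=> z; apply: cvgB; apply: cvgM; try exact: cvg_cst.
    exact: continuous_expR.
  by apply: cvgD; [exact: cvg_cst|exact: cvg_id].
have f0 : f 0 = - p by rewrite /f /a expR0; ring.
have fT : 0 <= f T.
  have hT : h * T = 4 * a by rewrite /T; field; rewrite gt_eqF.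
  have -> : f T = h * expR (T / 2) ^+ 2 - a * (1 + T).
    by rewrite -expRM_natr /f; congr (_ * expR _ - _); field.
  have e : (1 + T / 2) ^+ 2 <= expR (T / 2) ^+ 2.
    rewrite ler_sqr ?nnegrE ?expR_ge0 ?expR_ge1Dx//.
    by rewrite addr_ge0// divr_ge0// ltW.
  rewrite subr_ge0 (le_trans _ (ler_wpM2l (ltW h0) e))//.
  have -> : h * (1 + T / 2) ^+ 2 = h + h * T + h * T * (T / 4) by field.
  by rewrite hT; lra.
have [|t t0T ft] := @IVT _ f 0 T 0 (ltW T0) (continuous_subspaceT fc).
  by rewrite ge_min f0 le_max oppr_le0 (ltW p0) fT orbT.
exists t; last by apply/esym/eqP; rewrite -subr_eq0; apply/eqP.
rewrite lt_neqAle; move: t0T; rewrite in_itv/= => /andP[-> _]; rewrite andbT.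
by apply: contra_eq_neq ft => <-; rewrite f0 oppr_eq0 gt_eqF.
Qed.

(** h e^s = a (1 + t) e^{s-t} >= a (1 + t)(1 + s - t), and the last product exceeds a (1 + s) by a t
    (s - t) >= 0. *)
Lemma expR_affine_le (R : realType) (h a t s : R) : 0 < a -> 0 <= t ->
  a * (1 + t) = h * expR t -> t <= s -> a * (1 + s) <= h * expR s.
Proof.
move=> a0 t0 root ts.
have -> : h * expR s = a * (1 + t) * expR (s - t).
  by rewrite root -mulrA -expRD addrC subrK.
have e := expR_ge1Dx (s - t).
have at0 : 0 <= a * (1 + t) by rewrite mulr_ge0 ?addr_ge0// ltW.
rewrite (le_trans _ (ler_wpM2l at0 e))// -mulrA ler_pM2l//.
by rewrite -subr_ge0 (_ : _ - _ = t * (s - t)) ?mulr_ge0 ?subr_ge0//; ring.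
Qed.

(** After multiplication by 1 + t - s > 0, the left side is at most h e^t = a (1 + t), and the right
    side exceeds a (1 + t) by a s (t - s) >= 0. *)
Lemma expR_affine_ge (R : realType) (h a t s : R) : 0 < h -> 0 < a -> 0 <= s ->
  a * (1 + t) = h * expR t -> s <= t -> h * expR s <= a * (1 + s).
Proof.
move=> h0 a0 s0 root st.
have u0 : 0 < 1 + (t - s) by rewrite ltr_wpDr// subr_ge0.
rewrite -(ler_pM2r u0) (@le_trans _ _ (h * expR t))//.
  have -> : expR t = expR s * expR (t - s) by rewrite -expRD addrC subrK.
  by rewrite -mulrA ler_pM2l// ler_pM2l ?expR_gt0// expR_ge1Dx.
rewrite -root -mulrA ler_pM2l//.
by rewrite -subr_ge0 (_ : _ - _ = s * (t - s)) ?mulr_ge0 ?subr_ge0//; ring.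
Qed.

(** [slope] says that the derivative at the left end x is nonnegative. With E = e^{-xQ} and F =
    e^{-Q(y-x)}, the cost difference times xy is (h + p) E x (F - (1 - Q(y - x))) + (y - x)(h - (h +
    p)(1 + Qx) E). The first term is positive and the second nonnegative. *)
Lemma newsvendor_cost_incr (R : realType) (h p Q x y : R) :
  0 < h -> 0 < p -> 0 < Q -> 0 < x -> x < y ->
  (h + p) * (1 + Q * x) <= h * expR (Q * x) ->
  newsvendor_cost h p Q x < newsvendor_cost h p Q y.
Proof.
move=> h0 p0 Q0 x0 xy slope.
have y0 := lt_trans x0 xy.
rewrite !newsvendor_costE ?(ltW Q0)// ltrD2l ltr_pdivrMr// mulrAC ltr_pdivlMr//.
rewrite -subr_gt0.
have eE : expR (- y * Q) = expR (- x * Q) * expR (- (Q * (y - x))).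
  by rewrite -expRD; congr expR; ring.
(* This form of h turns [slope] times E into the bound [ub]. *)
have ea : h = h * expR (Q * x) * expR (- x * Q).
  by rewrite -mulrA -expRD (_ : _ + _ = 0) ?expR0 ?mulr1//; ring.
have d0 : - (Q * (y - x)) != 0 by rewrite oppr_eq0 mulf_neq0// ?subr_eq0 gt_eqF.
have := expR_gt1Dx d0; have := expR_gt0 (- x * Q).
rewrite eE; move: (expR (- _)) (expR (- x * _)) ea => F E ea E0 FF.
have ub : (h + p) * (1 + Q * x) * E <= h by rewrite [leRHS]ea ler_pM2r.
have : 0 < (h + p) * E * x * (F - (1 - Q * (y - x))).
  by rewrite !mulr_gt0 ?subr_gt0 ?addr_gt0.
have : 0 <= (y - x) * (h - (h + p) * (1 + Q * x) * E).
  by rewrite mulr_ge0 ?subr_ge0// ltW.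
lra.
Qed.

(** The mirror image, expanded at the right end: E = e^{-yQ}, F = e^{Q(y-x)}, and [slope] makes the
    derivative at y nonpositive. *)
Lemma newsvendor_cost_decr (R : realType) (h p Q x y : R) :
  0 < h -> 0 < p -> 0 < Q -> 0 < x -> x < y ->
  h * expR (Q * y) <= (h + p) * (1 + Q * y) ->
  newsvendor_cost h p Q y < newsvendor_cost h p Q x.
Proof.
move=> h0 p0 Q0 x0 xy slope.
have y0 := lt_trans x0 xy.
rewrite !newsvendor_costE ?(ltW Q0)// ltrD2l ltr_pdivrMr// mulrAC ltr_pdivlMr//.
rewrite -subr_gt0.
have eE : expR (- x * Q) = expR (- y * Q) * expR (Q * (y - x)).
  by rewrite -expRD; congr expR; ring.
have ea : h = h * expR (Q * y) * expR (- y * Q).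
  by rewrite -mulrA -expRD (_ : _ + _ = 0) ?expR0 ?mulr1//; ring.
have d0 : Q * (y - x) != 0 by rewrite mulf_neq0// ?subr_eq0 gt_eqF.
have := expR_gt1Dx d0; have := expR_gt0 (- y * Q).
rewrite eE; move: (expR (_ * (y - x))) (expR (- y * _)) ea => F E ea E0 FF.
have ub : h <= (h + p) * (1 + Q * y) * E by rewrite [leLHS]ea ler_pM2r.
have : 0 < (h + p) * E * y * (F - (1 + Q * (y - x))).
  by rewrite !mulr_gt0 ?subr_gt0 ?addr_gt0.
have : 0 <= (y - x) * ((h + p) * (1 + Q * y) * E - h).
  by rewrite mulr_ge0 ?subr_ge0// ltW.
lra.
Qed.

Lemma newsvendor_cost_cvg0 (R : realType) (h p Q : R) :
  0 < h -> 0 < p -> 0 <= Q ->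
  newsvendor_cost h p Q l @[l --> 0^'+] --> +oo.
Proof.
move=> h0 p0 Q0; apply/cvgryPge => A.
(* A positive bound above A + pQ, so that every l <= p / B works. *)
pose B := `|A + p * Q| + 1.
have B0 : 0 < B by rewrite ltr_wpDl.
near=> l.
have l0 : 0 < l by near: l; exact: nbhs_right_gt.
apply: le_trans (newsvendor_cost_ge h0 p0 Q0 l0).
rewrite lerBrDr (@le_trans _ _ B)//.
  by rewrite (le_trans (ler_norm _))// lerDl.
rewrite ler_pdivlMr// mulrC -ler_pdivlMr//.
by near: l; apply: nbhs_right_le; rewrite divr_gt0.
Unshelve. all: by end_near. Qed.

(** Since 0 <= e^{-lQ} <= 1, the cost lies between hQ - h/l and hQ + p/l. *)
Lemma newsvendor_cost_cvgy (R : realType) (h p Q : R) :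
  0 < h -> 0 < p -> 0 <= Q ->
  newsvendor_cost h p Q l @[l --> +oo] --> h * Q.
Proof.
move=> h0 p0 Q0.
have inv0 (c : R) : h * Q + c / l @[l --> +oo] --> h * Q.
  rewrite -[X in _ --> X]addr0 -[X in _ --> _ + X](mulr0 c).
  apply: cvgD; first exact: cvg_cst.
  apply: cvgM; first exact: cvg_cst.
  by apply/gtr0_cvgV0; [exact: nbhs_pinfty_gt|exact: cvg_id].
apply: squeeze_cvgr (inv0 (- h)) (inv0 p).
near=> l.
have l0 : 0 < l by near: l; exact: nbhs_pinfty_gt.
rewrite newsvendor_costE// !lerD2l !ler_pM2r ?invr_gt0//.
have e1 : expR (- l * Q) <= 1 by rewrite expR_le1 mulNr oppr_le0 mulr_ge0// ltW.
have a0 := ltW (addr_gt0 h0 p0).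
have := mulr_ge0 a0 (expR_ge0 (- l * Q)); have := ler_wpM2l a0 e1.
lra.
Unshelve. all: by end_near. Qed.

(** The claim amounts to h + p < h e^{lQ}. The threshold on l gives h + p <= h (1 + lQ), and 1 + lQ
    < e^{lQ}. *)
Lemma newsvendor_cost_lt (R : realType) (h p Q l : R) :
  0 < h -> 0 < p -> 0 < Q -> 0 < l -> p / (h * Q) <= l ->
  newsvendor_cost h p Q l < h * Q.
Proof.
move=> h0 p0 Q0 l0; rewrite ler_pdivrMr ?mulr_gt0// => pl.
rewrite newsvendor_costE ?ltW// -ltrBrDl subrr.
rewrite pmulr_llt0 ?invr_gt0// subr_lt0 mulNr expRN ltr_pdivrMr ?expR_gt0//.
have lQ0 : l * Q != 0 by rewrite mulf_neq0// gt_eqF.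
have := expR_gt1Dx lQ0; rewrite -(ltr_pM2l h0); apply: le_lt_trans.
by rewrite mulrDr mulr1 lerD2l mulrCA.
Qed.

(** Both monotonicity ranges include [ls] itself, so its value is strictly below that at any other
    positive rate. *)
Lemma unique_global_min_of_monotone (R : realType) (G : R -> R) (ls : R) :
  0 < ls -> (forall x y, ls <= x -> x < y -> G x < G y) ->
  (forall x y, 0 < x -> y <= ls -> x < y -> G y < G x) ->
  unique (is_global_min G) ls.
Proof.
move=> ls_gt0 incr decr; split.
  split=> // m m_gt0; case: (ltgtP m ls) => [mls|lsm|->//]; apply: ltW.
    exact: decr.
  exact: incr.
move=> m [m_gt0 /(_ ls ls_gt0) Gm]; apply/eqP; move: Gm.
apply: contraLR => lsm; rewrite -ltNge; move: lsm.
by rewrite neq_lt => /orP[/incr|/decr]; apply.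
Qed.

(** At Q = 0 the cost is p / l, which tends to 0 from above and attains no minimum; hence the guard
    0 < Q on the last claims. *)
Theorem theorem1 (R : realType) (h p Q : R)
    (h_gt0 : 0 < h) (p_gt0 : 0 < p) (Q_ge0 : 0 <= Q) :
  let G := newsvendor_cost h p Q in
  [/\ G l @[l --> 0^'+] --> +oo,
      G l @[l --> +oo] --> h * Q &
      0 < Q ->
      G l @[l --> +oo] --> (h * Q)^'- /\
      exists ls : R,
        [/\ unique (is_global_min G) ls,
            {in `]ls, +oo[ &, forall x y : R, x < y -> G x < G y} &
            {in `]0, ls[ &, forall x y : R, x < y -> G y < G x}]].
Proof.
move=> G; split; [exact: newsvendor_cost_cvg0|exact: newsvendor_cost_cvgy|].
move=> Q_gt0; split.
  have G_lt : \forall l \near +oo, G l < h * Q.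
    apply: filterS2 (nbhs_pinfty_gt (num_real 0))
                    (nbhs_pinfty_ge (num_real (p / (h * Q)))) => l.
    exact: newsvendor_cost_lt.
  (* A left neighbourhood of hQ constrains only values below hQ, so the ordinary limit and [G_lt]
     together suffice. *)
  move=> A /(newsvendor_cost_cvgy h_gt0 p_gt0 Q_ge0) GA.
  by apply: filterS2 GA G_lt => l /[apply].
have a_gt0 := addr_gt0 h_gt0 p_gt0.
have [t t_gt0 root] := expR_affine_root h_gt0 p_gt0.
(* The root t is the critical value of lQ; the comparison lemmas give the sign of the slope on
   either side of it. *)
pose ls := t / Q.
have ls_gt0 : 0 < ls by rewrite divr_gt0.
have incr x y : ls <= x -> x < y -> G x < G y.
  move=> lsx xy; have x_gt0 := lt_le_trans ls_gt0 lsx.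
  apply: newsvendor_cost_incr => //.
  apply: expR_affine_le (ltW t_gt0) root _ => //.
  by rewrite mulrC -ler_pdivrMr.
have decr x y : 0 < x -> y <= ls -> x < y -> G y < G x.
  move=> x_gt0 yls xy; apply: newsvendor_cost_decr => //.
  apply: expR_affine_ge root _ => //.
    by rewrite mulr_ge0// ltW// (lt_trans x_gt0).
  by rewrite mulrC -ler_pdivlMr.
exists ls; split.
- exact: unique_global_min_of_monotone.
- move=> x y; rewrite !in_itv/= !andbT => lsx _; apply: incr.
  exact: ltW.
- move=> x y; rewrite !in_itv/= => /andP[x_gt0 _] /andP[_ yls].
  by apply: decr => //; exact: ltW.
Qed.
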